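(* Let $(q_i)_{i\ge 1}$ be a sequence of pairwise distinct odd primes and let $G=\bigoplus_{i\ge 1}\mathbb Z[1/q_i]$ (a group under addition). Then $G$ is residually finite and Hopfian, but its profinite completion $\widehat G$ is not topologically Hopfian.
   Context: An abstract group is Hopfian if every surjective endomorphism of it is injective. A topological group is topologically Hopfian if every continuous surjective endomorphism of it is injective. The profinite completion of an abelian group $A$ is the profinite group $\widehat A=\varprojlim_{N\le A,\ [A:N]<\infty}A/N$ with the inverse limit topology. Here $\mathbb Z[1/q]$ denotes the additive group of the subring of $\mathbb Q$ generated by $1/q$. *)

(* Defs.v *)
From HB Require Import structures.
From mathcomp Require Import all_boot all_order all_algebra generic_quotient.
From mathcomp Require Import ring_quotient.
From mathcomp Require Import mathcomp_extra boolp classical_sets functions.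
From mathcomp Require Import cardinality.
From mathcomp Require Import topology tvs.

Set Implicit Arguments.
Unset Strict Implicit.
Unset Printing Implicit Defensive.

Import GRing.Theory.
Local Open Scope quotient_scope.
Local Open Scope classical_set_scope.
Local Open Scope ring_scope.

Definition hopfian (A : zmodType) : Prop :=
  forall f : {additive A -> A}, (forall y, exists x, f x = y) -> injective f.

Definition topologically_hopfian (T : topologicalZmodType) : Prop :=
  forall f : {additive T -> T},
    continuous f -> (forall y, exists x, f x = y) -> injective f.

(* Every subgroup of [A] is a [zmodClosed A], its (Boolean) membership
   predicate being obtained classically with [asbool]. *)
Record finindex (A : zmodType) := Finindex {
  finindex_group :> zmodClosed A;
  finindex_finite : finite_set [set: {ideal_quot finindex_group}]
}.

HB.instance Definition _ A := gen_eqMixin (finindex A).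
HB.instance Definition _ A := gen_choiceMixin (finindex A).

Definition residually_finite (A : zmodType) : Prop :=
  forall x : A, x != 0 -> exists N : finindex A, x \notin (N : zmodClosed A).

(* An alias of the dependent product, so that its group structure does not
   clash with the library's one on the non-dependent [I -> V]. *)
Definition zprod (I : Type) (A : I -> zmodType) : Type := forall i, A i.

Section ZProd.
Context {I : Type} (A : I -> zmodType).
Implicit Types x y z : zprod A.

HB.instance Definition _ := Choice.copy (zprod A) (forall i, A i).

Definition zprod_zero : zprod A := fun=> 0.
Definition zprod_opp x : zprod A := fun i => - x i.
Definition zprod_add x y : zprod A := fun i => x i + y i.

Lemma zprod_addA : associative zprod_add.
Proof. by move=> x y z; apply: functional_extensionality_dep => i; exact: addrA. Qed.
Lemma zprod_addC : commutative zprod_add.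
Proof. by move=> x y; apply: functional_extensionality_dep => i; exact: addrC. Qed.
Lemma zprod_add0 : left_id zprod_zero zprod_add.
Proof. by move=> x; apply: functional_extensionality_dep => i; exact: add0r. Qed.
Lemma zprod_addN : left_inverse zprod_zero zprod_opp zprod_add.
Proof. by move=> x; apply: functional_extensionality_dep => i; exact: addNr. Qed.

HB.instance Definition _ := GRing.isZmodule.Build (zprod A)
  zprod_addA zprod_addC zprod_add0 zprod_addN.

Lemma zprodD x y i : (x + y) i = x i + y i. Proof. by []. Qed.
Lemma zprodN x i : (- x) i = - x i. Proof. by []. Qed.
Lemma zprodB x y i : (x - y) i = x i - y i. Proof. by []. Qed.
Lemma zprod0 i : (0 : zprod A) i = 0. Proof. by []. Qed.

Definition finsupp : {pred zprod A} :=
  [pred x : zprod A | `[< finite_set [set i | x i != 0] >]].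

Lemma finsupp_zmod_closed : zmod_closed finsupp.
Proof.
split=> [|x y /asboolP fx /asboolP fy]; apply/asboolP.
  rewrite (_ : [set _ | _] = set0) //.
  by apply/seteqP; split=> // i /=; rewrite zprod0 eqxx.
apply: (@sub_finite_set _ _ ([set i | x i != 0] `|` [set i | y i != 0])).
  move=> i /=; rewrite zprodB; have [->|] := eqVneq (x i) 0; last by left.
  by rewrite add0r oppr_eq0; right.
by rewrite finite_setU.
Qed.
HB.instance Definition _ :=
  GRing.isZmodClosed.Build (zprod A) finsupp finsupp_zmod_closed.

Record direct_sum := DirectSum {
  direct_sum_val :> zprod A;
  direct_sumP : direct_sum_val \in finsupp
}.

HB.instance Definition _ := [isSub for direct_sum_val].
HB.instance Definition _ := [Choice of direct_sum by <:].
HB.instance Definition _ := [SubChoice_isSubZmodule of direct_sum by <:].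

End ZProd.

Section ProfiniteCompletion.
Context (A : zmodType).

(* The canonical map A/N -> A/M, well defined when N is contained in M; it is
   only used in that case. *)
Definition quot_proj (N M : zmodClosed A) (x : {ideal_quot N}) :
  {ideal_quot M} := \pi_({ideal_quot M}) (repr x).

Lemma quot_projE (N M : zmodClosed A) (a : A) : {subset N <= M} ->
  quot_proj M (\pi_({ideal_quot N}) a) = \pi_({ideal_quot M}) a.
Proof.
move=> NM; apply/eqP; rewrite /quot_proj -Quotient.idealrBE; apply: NM.
by rewrite Quotient.idealrBE reprK.
Qed.

Lemma quot_projB (N M : zmodClosed A) (x y : {ideal_quot N}) :
  {subset N <= M} -> quot_proj M (x - y) = quot_proj M x - quot_proj M y.
Proof.
move=> NM; rewrite -[x]reprK -[y]reprK -raddfB !quot_projE //.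
by rewrite raddfB.
Qed.

Definition coherent : {pred zprod (fun N : finindex A => {ideal_quot N})} :=
  [pred x : zprod (fun N : finindex A => {ideal_quot N}) |
    `[< forall N M : finindex A,
          {subset (N : zmodClosed A) <= (M : zmodClosed A)} ->
          quot_proj M (x N) = x M >]].

Lemma coherent_zmod_closed : zmod_closed coherent.
Proof.
split=> [|x y /asboolP cx /asboolP cy]; apply/asboolP => N M NM.
  by rewrite !zprod0 -[0 in LHS](raddf0 \pi_({ideal_quot N})) quot_projE ?raddf0.
by rewrite !zprodB quot_projB // cx // cy.
Qed.
HB.instance Definition _ := GRing.isZmodClosed.Build
  (zprod (fun N : finindex A => {ideal_quot N})) coherent coherent_zmod_closed.

Record profinite_completion := ProfiniteCompletion {
  completion_val :> zprod (fun N : finindex A => {ideal_quot N});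
  completionP : completion_val \in coherent
}.

HB.instance Definition _ := [isSub for completion_val].
HB.instance Definition _ := [Choice of profinite_completion by <:].
HB.instance Definition _ := [SubChoice_isSubZmodule of profinite_completion by <:].

Lemma completion_valB (x y : profinite_completion) :
  completion_val (x - y) = completion_val x - completion_val y.
Proof. exact: (raddfB \val). Qed.

Definition completion_incl (x : profinite_completion) :
    prod_topology (fun N : finindex A => discrete_topology {ideal_quot N}) :=
  completion_val x.

HB.instance Definition _ := Topological.copy profinite_completion
  (initial_topology completion_incl).

Lemma completion_coord_continuous (N : finindex A) :
  continuous
    (fun x => completion_val x N : discrete_topology {ideal_quot N}).
Proof.
pose K (M : finindex A) : topologicalType :=
  discrete_topology {ideal_quot M}.
have cN : continuous (proj N : prod_topology K -> K N).
  exact: (@proj_continuous _ K N).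
have ci : continuous (completion_incl : _ -> prod_topology K).
  exact: (@initial_continuous _ (prod_topology K) completion_incl).
move=> x; apply: (@continuous_comp _ _ _
  (completion_incl : _ -> prod_topology K) (proj N : _ -> K N)).
- exact: ci.
- exact: cN.
Qed.

Lemma completion_continuous (X : topologicalType)
    (f : X -> profinite_completion) :
  (forall N : finindex A,
    continuous (fun x => completion_val (f x) N : discrete_topology {ideal_quot N})) ->
  continuous f.
Proof.
move=> fc; apply: continuous_comp_initial => x.
apply/cvg_sup => N.
apply: (@continuous_comp_initial _ _ _ _ (fun x => completion_incl (f x))).
exact: fc.
Qed.

Lemma completion_sub_continuous :
  continuous (fun x : profinite_completion * profinite_completion => x.1 - x.2).
Proof.
apply: completion_continuous => N x.
apply/discrete_cvg.
have cN (z : profinite_completion) :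
    nbhs z [set y | completion_val y N = completion_val z N].
  have /(_ _ (@discrete_set1 (discrete_topology {ideal_quot N}) _)) :=
    @completion_coord_continuous N z.
  by [].
exists ([set y | completion_val y N = completion_val x.1 N],
        [set y | completion_val y N = completion_val x.2 N]).
  by split; apply: cN.
move=> [y z] [/= yx zx].
change (completion_val (y - z) N = completion_val (x.1 - x.2) N).
by rewrite !completion_valB !zprodB yx zx.
Qed.

HB.instance Definition _ := PreTopologicalNmodule_isTopologicalZmodule.Build
  profinite_completion completion_sub_continuous.

End ProfiniteCompletion.

(* The subring of rat generated by 1/q, as the intersection of all subrings
   containing 1/q. *)
Definition Zinv_pred (q : nat) : {pred rat} :=
  [pred x : rat | `[< forall S : subringClosed rat, q%:R^-1 \in S -> x \in S >]].

Lemma Zinv_subring_closed q : subring_closed (Zinv_pred q).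
Proof.
split=> [|x y /asboolP Sx /asboolP Sy|x y /asboolP Sx /asboolP Sy];
  apply/asboolP => S Sq.
- exact: rpred1.
- by rewrite rpredB ?Sx ?Sy.
- by rewrite rpredM ?Sx ?Sy.
Qed.
HB.instance Definition _ q :=
  GRing.isSubringClosed.Build rat (Zinv_pred q) (Zinv_subring_closed q).

Record Zinv (q : nat) := MkZinv {
  Zinv_val :> rat;
  ZinvP : Zinv_val \in Zinv_pred q
}.

HB.instance Definition _ q := [isSub for @Zinv_val q].
HB.instance Definition _ q := [Choice of Zinv q by <:].
HB.instance Definition _ q := [SubChoice_isSubComNzRing of Zinv q by <:].

(* Main.v *)
(* Since Z[1/p] is p-divisible and Z[1/q] has no nonzero p-divisible element for
   p <> q, every endomorphism of G is diagonal, and a surjective endomorphism of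
   Z[1/q] is injective because Z[1/q] has rank one; hence G is Hopfian.
   Reduction modulo powers of 2, possible as every q_i is odd, separates the
   points of G.  Finally 2 is invertible in none of the Z[1/q_i], so all these
   groups have the same pro-2 completion Z_2, and the completion of G splits as
   its 2-primary part, on which one can shift the coordinates, and its odd part.
   The downward shift on the 2-primary part, extended by the identity on the odd
   part, is continuous, has the upward shift as a right inverse, and kills the
   2-primary part of the 0-th basis vector. *)

Require Import Defs.
From HB Require Import structures.
From mathcomp Require Import all_boot all_order all_algebra generic_quotient.
From mathcomp Require Import ring_quotient.
From mathcomp Require Import mathcomp_extra boolp classical_sets functions.
From mathcomp Require Import cardinality fsbigop.
From mathcomp Require Import topology tvs.

Set Implicit Arguments.
Unset Strict Implicit.
Unset Printing Implicit Defensive.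

Import Order.TTheory GRing.Theory Num.Theory.
Local Open Scope quotient_scope.
Local Open Scope classical_set_scope.
Local Open Scope ring_scope.

(** * Multiplication by fractions of odd denominator on torsion groups *)

Definition torsion (A : zmodType) (b : A) : Prop :=
  exists2 n, (0 < n)%N & b *+ n = 0.

Section LocalAction.

(** The fraction need not be reduced: expanding it by an odd factor lets an equation
    [b *~ a = c *~ d] ignore the odd part of [b]. *)
Definition is_frac (x : rat) (a : int) (d : nat) : Prop :=
  odd d /\ x * d%:R = a%:~R.

Definition odd_denom (x : rat) : Prop := exists a d, is_frac x a d.

(* On a torsion group, [c] is the image of the 2-primary component of [b]
   under multiplication by [x], an element of the localisation of Z at 2. *)
Definition locmul_rel (A : zmodType) (x : rat) (b c : A) : Prop :=
  (exists k, c *+ 2 ^ k = 0) /\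
  exists a d, is_frac x a d /\ b *~ a = c *~ d.

(** A value is always unique, and exists when [b] is torsion and [x] has odd denominator; the
    default 0 makes the operation total. *)
Definition locmul (A : zmodType) (x : rat) (b : A) : A :=
  xget 0 [set c | locmul_rel x b c].

Variable A : zmodType.
Implicit Types (b c : A) (x y : rat).

Lemma odd_denom1 : odd_denom 1.
Proof. by exists 1, 1%N. Qed.

(** Bezout: 1 is a combination of [2 ^ k] and [d], both of which kill [c]. *)
Lemma mulrn_pow2_odd_eq0 c k d : c *+ 2 ^ k = 0 -> odd d -> c *~ d = 0 -> c = 0.
Proof.
move=> c2 d_odd cd.
have [u [v uv]] := Bezoutz (2 ^ k)%N d.
have g1 : gcdz (2 ^ k)%N d = 1.
  by apply/eqP; rewrite -[_ == _]/(coprime _ _) coprimeXl ?coprime2n.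
rewrite -[c]mulr1z -g1 -uv mulrzDr mulrC [v * _]mulrC !mulrzA cd.
by rewrite -pmulrn c2 !mul0rz addr0.
Qed.

(** The difference of two values is killed by a power of 2 and, after cross-multiplying the two
    fractions, by the odd number [d * d']. *)
Lemma locmul_rel_inj x b c c' :
  locmul_rel x b c -> locmul_rel x b c' -> c = c'.
Proof.
move=> [[k ck] [a [d [[d_odd xd] bc]]]] [[k' ck'] [a' [d' [[d'_odd xd'] bc']]]].
apply/eqP; rewrite -subr_eq0; apply/eqP.
apply: (@mulrn_pow2_odd_eq0 _ (k + k') (d * d')); last 1 first.
- have aa' : a * d' = a' * d :> int.
    by apply: (@intr_inj rat); rewrite !intrM -xd -xd' mulrAC.
  rewrite PoszM mulrzBl mulrzA -bc [d%:Z * d']mulrC [in X in _ - X]mulrzA -bc'.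
  by rewrite -!mulrzA aa' subrr.
- rewrite mulrnBl expnD mulrnA ck mul0rn mulnC mulrnA ck' mul0rn subrr //.
- by rewrite oddM d_odd.
Qed.

Lemma locmul_rel_total x b : odd_denom x -> torsion b ->
  exists c, locmul_rel x b c.
Proof.
move=> [a [d [d_odd xd]]] [n n_gt0 bn].
have [m cm nE] := pfactor_coprime (isT : prime 2) n_gt0.
set k := logn 2 n in nE; have m_odd : odd m by rewrite -coprime2n.
have [u [v uv]] := Bezoutz (d * m)%N (2 ^ k)%N.
have g1 : gcdz (d * m)%N (2 ^ k)%N = 1.
  by apply/eqP; rewrite -[_ == _]/(coprime _ _) coprimeXr // coprimen2 oddM d_odd.
have bz z : b *~ (z * n%:Z) = 0 by rewrite mulrC mulrzA -pmulrn bn mul0rz.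
(* The factor [m], the odd part of [n], projects to the 2-primary part, and [u] inverts [d * m]
   modulo [2 ^ k]. The fraction is expanded by [m] to match. *)
exists (b *~ (a * m * u)); split.
  exists k; rewrite pmulrn -mulrzA.
  by rewrite (_ : _ * _ = a * u * n%:Z) ?bz // nE PoszM -!mulrA [m%:Z * (u * _)]mulrCA.
exists (a * m%:Z), (d * m)%N; split.
  by split; [rewrite oddM d_odd | rewrite natrM mulrA xd intrM].
rewrite -mulrzA; apply/eqP; rewrite -subr_eq0 -mulrzBr; apply/eqP.
rewrite (_ : _ - _ = a * v * n%:Z) ?bz // nE -[a * m%:Z * u * _]mulrA.
rewrite -[X in X - _]mulr1 -mulrBr -{1}g1 -uv addrC addKr PoszM.
by rewrite -!mulrA [m%:Z * (v * _)]mulrCA.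
Qed.

Lemma locmul_relP x b : odd_denom x -> torsion b ->
  locmul_rel x b (locmul x b).
Proof. by move=> hx tb; apply: xgetPex; apply: locmul_rel_total. Qed.

Lemma locmul_eq x b c : locmul_rel x b c -> locmul x b = c.
Proof.
by move=> h; apply: xget_unique => // c' h'; exact: locmul_rel_inj h' h.
Qed.

Lemma is_fracD x y a a' d d' : is_frac x a d -> is_frac y a' d' ->
  is_frac (x + y) (a * d'%:Z + a' * d%:Z) (d * d').
Proof.
move=> [d_odd xd] [d'_odd xd']; split; first by rewrite oddM d_odd.
by rewrite natrM intrD !intrM -xd -xd' mulrDl !mulrA [y * _ * _]mulrAC.
Qed.

Lemma is_fracN x a d : is_frac x a d -> is_frac (- x) (- a) d.
Proof. by move=> [d_odd xd]; split=> //; rewrite mulNr xd rmorphN. Qed.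

Lemma is_fracM x y a a' d d' : is_frac x a d -> is_frac y a' d' ->
  is_frac (x * y) (a * a') (d * d').
Proof.
move=> [d_odd xd] [d'_odd xd']; split; first by rewrite oddM d_odd.
by rewrite natrM intrM -xd -xd' mulrACA.
Qed.

Lemma pow2_torsionB c c' : (exists k, c *+ 2 ^ k = 0) ->
  (exists k, c' *+ 2 ^ k = 0) -> exists k, (c - c') *+ 2 ^ k = 0.
Proof.
move=> [k ck] [k' ck']; exists (k + k')%N.
by rewrite mulrnBl expnD mulrnA ck mul0rn mulnC mulrnA ck' mul0rn subrr.
Qed.

Lemma locmul_relBl x y b c c' : locmul_rel x b c -> locmul_rel y b c' ->
  locmul_rel (x - y) b (c - c').
Proof.
move=> [kc [a [d [fx bc]]]] [kc' [a' [d' [fy bc']]]].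
split; first exact: pow2_torsionB.
exists (a * d'%:Z + - a' * d%:Z), (d * d')%N; split.
  by apply: is_fracD => //; apply: is_fracN.
rewrite mulNr mulrzBr !mulrzA bc bc' PoszM mulrzBl -!mulrzA.
by rewrite [d'%:Z * _]mulrC.
Qed.

Lemma locmul_relBr x b b' c c' : locmul_rel x b c -> locmul_rel x b' c' ->
  locmul_rel x (b - b') (c - c').
Proof.
move=> [kc [a [d [fx bc]]]] [kc' [a' [d' [fx' bc']]]].
split; first exact: pow2_torsionB.
have [d_odd xd] := fx; have [d'_odd xd'] := fx'.
exists (a * d'%:Z), (d * d')%N; split.
  by split; rewrite ?oddM ?d_odd // natrM intrM -xd mulrA.
have aa' : a * d' = a' * d :> int.
  by apply: (@intr_inj rat); rewrite !intrM -xd -xd' mulrAC.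
rewrite PoszM !mulrzBl mulrzA bc aa' mulrzA bc' -!mulrzA.
by rewrite [d'%:Z * _]mulrC.
Qed.

Lemma locmul_relM x y b c c' : locmul_rel x b c -> locmul_rel y c c' ->
  locmul_rel (y * x) b c'.
Proof.
move=> [_ [a [d [fx bc]]]] [kc' [a' [d' [fy cc']]]]; split=> //.
exists (a' * a), (d' * d)%N; split; first exact: is_fracM.
by rewrite mulrC mulrzA bc -mulrzA mulrC mulrzA cc' PoszM mulrzA.
Qed.

(** Here [b'] plays the role of [y] times [b]. It is only constrained by an equation, which leaves
    its odd part free, but [c] sees just the 2-primary part. *)
Lemma locmul_rel_frac x y b b' c a d : is_frac y a d -> b' *~ d = b *~ a ->
  locmul_rel x b' c -> locmul_rel (x * y) b c.
Proof.
move=> fy bb' [kc [a' [d' [fx b'c]]]]; split=> //.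
exists (a' * a), (d' * d)%N; split; first exact: is_fracM.
by rewrite mulrC mulrzA -bb' -mulrzA mulrC mulrzA b'c PoszM mulrzA.
Qed.

Lemma locmulBl x y b : odd_denom x -> odd_denom y -> torsion b ->
  locmul (x - y) b = locmul x b - locmul y b.
Proof.
by move=> hx hy tb; apply/locmul_eq/locmul_relBl; apply: locmul_relP.
Qed.

Lemma locmulBr x b b' : odd_denom x -> torsion b -> torsion b' ->
  locmul x (b - b') = locmul x b - locmul x b'.
Proof.
by move=> hx tb tb'; apply/locmul_eq/locmul_relBr; apply: locmul_relP.
Qed.

Lemma torsion_locmul x b : torsion b -> torsion (locmul x b).
Proof.
move=> tb; rewrite /locmul; case: xgetP => [c _ [[k ck] _]|_].
  by exists (2 ^ k)%N => //; rewrite expn_gt0.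
by exists 1%N.
Qed.

Lemma locmulM x y b : odd_denom x -> odd_denom y -> torsion b ->
  locmul y (locmul x b) = locmul (y * x) b.
Proof.
move=> hx hy tb; apply/esym/locmul_eq.
by apply: locmul_relM; apply: locmul_relP => //; apply: torsion_locmul.
Qed.

End LocalAction.

(** The relation consists of equations between integer multiples, which every additive map
    preserves. *)
Lemma locmul_rel_morph (A B : zmodType) (f : {additive A -> B}) x b c :
  locmul_rel x b c -> locmul_rel x (f b) (f c).
Proof.
move=> [[k ck] [a [d [fx bc]]]]; split.
  by exists k; rewrite -raddfMn ck raddf0.
by exists a, d; split=> //; rewrite -!raddfMz bc.
Qed.

Lemma locmul_morph (A B : zmodType) (f : {additive A -> B}) x b :
  odd_denom x -> torsion b -> f (locmul x b) = locmul x (f b).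
Proof.
by move=> hx tb; apply/esym/locmul_eq/locmul_rel_morph/locmul_relP.
Qed.

(** Pigeonhole: two of the first [(size s).+1] multiples of [b] coincide, so the difference of their
    indices kills [b]. *)
Lemma finite_torsion (A : zmodType) (b : A) :
  finite_set [set: A] -> torsion b.
Proof.
move=> /finite_seqP[s sT].
have inS y : y \in s by have : [set: A] y by []; rewrite sT.
pose t := [seq b *+ i | i <- iota 0 (size s).+1].
have : ~~ uniq t.
  apply/negP => ut; have := uniq_leq_size ut (fun y _ => inS y).
  by rewrite size_map size_iota ltnn.
have [ti|/negP nti] := boolP [forall i : 'I_(size s).+1,
    forall j : 'I_(size s).+1, (b *+ i == b *+ j) ==> (i == j)].
  rewrite map_inj_in_uniq ?iota_uniq // => i j.
  rewrite !mem_iota !add0n /= => hi hj hij.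
  move/forallP: ti => /(_ (Ordinal hi))/forallP/(_ (Ordinal hj)) /=.
  by rewrite hij eqxx /= => /eqP[].
move=> _; move/negP: nti; rewrite negb_forall => /existsP[i].
rewrite negb_forall => /existsP[j]; rewrite negb_imply => /andP[/eqP].
wlog ij : i j / (i < j)%N => [H e n|e _].
  have [h|h|/val_inj h] := ltngtP i j; first exact: (H i j).
  - by apply: (H j i) => //; rewrite eq_sym.
  - by rewrite h eqxx in n.
by exists (j - i)%N; rewrite ?subn_gt0 // mulrnBr ?(ltnW ij) // e subrr.
Qed.

(** * Kernels of homomorphisms to finite groups *)

Section Kernel.
Variables (A B : zmodType) (f : {additive A -> B}).

Definition ker_pred : {pred A} := [pred x | f x == 0].

Lemma ker_zmod_closed : zmod_closed ker_pred.
Proof.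
split=> [|x y]; rewrite !inE ?raddf0 // => /eqP fx /eqP fy.
by rewrite raddfB fx fy subrr.
Qed.
HB.instance Definition _ := GRing.isZmodClosed.Build A ker_pred ker_zmod_closed.

Definition ker : zmodClosed A := ker_pred.

Lemma ker_finite : finite_set [set: B] -> finite_set [set: {ideal_quot ker}].
Proof.
move=> finB.
have -> : [set: {ideal_quot ker}] = (fun x => f (repr x)) @^-1` [set: B] by [].
apply: finite_preimage => // x y _ _ fxy.
rewrite -[x]reprK -[y]reprK; apply/eqP.
by rewrite -Quotient.idealrBE inE raddfB fxy subrr.
Qed.

Definition ker_finindex (finB : finite_set [set: B]) : finindex A :=
  Finindex (ker_finite finB).

(** The map induced by [f] on the quotient by its kernel, computed on representatives. *)
Definition ker_quot (x : {ideal_quot ker}) : B := f (repr x).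

Lemma ker_quotE a : ker_quot (\pi_({ideal_quot ker}) a) = f a.
Proof.
apply/eqP; rewrite /ker_quot -subr_eq0 -raddfB.
have : repr (\pi_({ideal_quot ker}) a) - a \in ker.
  by rewrite Quotient.idealrBE reprK.
by rewrite inE.
Qed.

Lemma ker_quot_zmod_morphism : zmod_morphism ker_quot.
Proof.
by move=> x y; rewrite -[x]reprK -[y]reprK -raddfB !ker_quotE raddfB.
Qed.
HB.instance Definition _ :=
  GRing.isZmodMorphism.Build {ideal_quot ker} B ker_quot ker_quot_zmod_morphism.

End Kernel.

Lemma residually_finite_separated (A : zmodType) :
  (forall x : A, x != 0 -> exists (B : zmodType) (f : {additive A -> B}),
    finite_set [set: B] /\ f x != 0) -> residually_finite A.
Proof.
move=> sepA x /sepA[B [f [finB fx]]].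
by exists (ker_finindex f finB); rewrite inE.
Qed.

(** * Coordinates and endomorphisms of the profinite completion *)

Section Completion.
Variable A : zmodType.
Local Notation Ahat := (profinite_completion A).
Implicit Types (N M : finindex A) (x y : Ahat).

Lemma pi_eq0 (N : zmodClosed A) a :
  (\pi_({ideal_quot N}) a == 0) = (a \in N).
Proof.
by rewrite -[in RHS](subr0 a) Quotient.idealrBE raddf0.
Qed.

Lemma finindex_torsion N (b : {ideal_quot N}) : torsion b.
Proof. exact/finite_torsion/finindex_finite. Qed.

Lemma completion_eq x y : (forall N, completion_val x N = completion_val y N) ->
  x = y.
Proof.
by move=> xy; apply: val_inj; apply: functional_extensionality_dep.
Qed.

Lemma completion_proj x N M : {subset (N : zmodClosed A) <= (M : zmodClosed A)} ->
  quot_proj M (completion_val x N) = completion_val x M.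
Proof. by move: (completionP x) => /asboolP; exact. Qed.

Definition coord N (x : Ahat) : {ideal_quot N} := completion_val x N.

Lemma coord_zmod_morphism N : zmod_morphism (coord N).
Proof. by move=> x y; rewrite /coord completion_valB. Qed.
HB.instance Definition _ N :=
  GRing.isZmodMorphism.Build Ahat {ideal_quot N} (coord N) (coord_zmod_morphism N).

Lemma completion_of_coherent
    (u : forall N, {ideal_quot N}) :
  (forall N M, {subset (N : zmodClosed A) <= (M : zmodClosed A)} ->
    quot_proj M (u N) = u M) ->
  (u : zprod (fun N : finindex A => {ideal_quot N})) \in @coherent A.
Proof. by move=> cu; apply/asboolP. Qed.

Definition incl (a : A) : Ahat :=
  ProfiniteCompletion (completion_of_coherent (fun N M => @quot_projE A N M a)).

Lemma coord_incl N a : coord N (incl a) = \pi_({ideal_quot N}) a.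
Proof. by []. Qed.

Lemma incl_zmod_morphism : zmod_morphism incl.
Proof.
by move=> a b; apply: completion_eq => N; rewrite completion_valB; exact: raddfB.
Qed.
HB.instance Definition _ :=
  GRing.isZmodMorphism.Build A Ahat incl incl_zmod_morphism.

Section QuotProj.
Variables (N M : zmodClosed A) (NM : {subset N <= M}).
(** The inclusion is kept as an argument so that the additive structure, valid only under it, can be
    attached to the map. *)
Definition quot_proj_sub of {subset N <= M} := @quot_proj A N M.
Lemma quot_proj_zmod_morphism : zmod_morphism (quot_proj_sub NM).
Proof. by move=> x y; exact: quot_projB. Qed.
HB.instance Definition _ := GRing.isZmodMorphism.Build
  {ideal_quot N} {ideal_quot M} (quot_proj_sub NM) quot_proj_zmod_morphism.
End QuotProj.

(** An algebraic form of continuity: each coordinate of the value is a homomorphic image of a single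
    coordinate of the argument. *)
Definition coordwise (H : Ahat -> Ahat) : Prop :=
  forall N, exists (K : finindex A) (h : {additive {ideal_quot K} -> {ideal_quot N}}),
    forall x, coord N (H x) = h (coord K x).

(** Each coordinate of [H] is constant on the neighbourhood of [x] where coordinate [K] does not
    change. *)
Lemma coordwise_continuous H : coordwise H -> continuous H.
Proof.
move=> cH; apply: completion_continuous => N; have [K [h hE]] := cH N.
move=> x; apply/discrete_cvg; first exact: (@fmap_filter _ _ _ _ (nbhs_filter x)).
have nx : nbhs x [set y | coord K y = coord K x].
  have /(_ _ (@discrete_set1 (discrete_topology {ideal_quot K}) _)) :=
    @completion_coord_continuous _ K x.
  by [].

change (nbhs x [set y | completion_val (H y) N = completion_val (H x) N]).
apply: filterS nx => y /= yx.
by rewrite -![completion_val _ N]/(coord N _) !hE yx.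
Qed.

Lemma coordwise_comp H H' : coordwise H -> coordwise H' -> coordwise (H \o H').
Proof.
move=> cH cH' N; have [K [h hE]] := cH N; have [L [h' h'E]] := cH' K.
by exists L, (h \o h') => x /=; rewrite hE h'E.
Qed.

(** This replaces density of [A] in its completion: each coordinate of [x] is the class of some
    element of [A], so [h] must be the projection from A/K to A/N. *)
Lemma coordwise_id H : coordwise H -> (forall a, H (incl a) = incl a) ->
  forall x, H x = x.
Proof.
move=> cH Hincl x; apply: completion_eq => N; have [K [h hE]] := cH N.
have hpi a : h (\pi_({ideal_quot K}) a) = \pi_({ideal_quot N}) a.
  by rewrite -coord_incl -hE Hincl.
have KN : {subset (K : zmodClosed A) <= (N : zmodClosed A)}.
  by move=> a; rewrite -!pi_eq0 -hpi => /eqP ->; rewrite raddf0.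
rewrite -(completion_proj x KN) -[LHS]/(coord N (H x)) hE /coord.
by rewrite -[completion_val x K]reprK hpi quot_projE.
Qed.

Section Extension.
Variable F : {additive A -> Ahat}.

Let FN N : {additive A -> {ideal_quot N}} := coord N \o F.
(** Coordinate [N] of [F] has finite target, so it factors through the quotient by its kernel [K N];
    this determines the extension of [F] to the completion. *)
Let K N : finindex A := ker_finindex (FN N) (@finindex_finite A N).
Let ext_val x N : {ideal_quot N} := ker_quot (coord (K N) x).

Lemma ext_coherent x N M : {subset (N : zmodClosed A) <= (M : zmodClosed A)} ->
  quot_proj M (ext_val x N) = ext_val x M.
Proof.
move=> NM; have KNM : {subset (K N : zmodClosed A) <= (K M : zmodClosed A)}.
  move=> a; rewrite !inE /= => /eqP FNa.
  rewrite /coord -(completion_proj _ NM) -[completion_val _ _]/(coord N _) FNa.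
  by rewrite -[quot_proj _]/(quot_proj_sub NM) raddf0.
rewrite /ext_val /coord -(completion_proj x KNM) -[completion_val x _]reprK.
rewrite quot_projE // !(ker_quotE (FN _)) /=.
exact: completion_proj.
Qed.

Definition ext x : Ahat :=
  ProfiniteCompletion (completion_of_coherent (@ext_coherent x)).

Lemma coord_ext N x : coord N (ext x) = ker_quot (coord (K N) x).
Proof. by []. Qed.

Lemma ext_zmod_morphism : zmod_morphism ext.
Proof.
move=> x y; apply: completion_eq => N.
by rewrite -!/(coord N _) raddfB !coord_ext !raddfB.
Qed.
HB.instance Definition _ :=
  GRing.isZmodMorphism.Build Ahat Ahat ext ext_zmod_morphism.

Lemma ext_incl a : ext (incl a) = F a.
Proof.
apply: completion_eq => N.
by rewrite -!/(coord N _) coord_ext coord_incl (ker_quotE (FN N)).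
Qed.

Lemma ext_coordwise : coordwise ext.
Proof. by move=> N; exists (K N), (ker_quot (f := FN N)) => x. Qed.

End Extension.

Lemma locmul_coherent r (r_odd : odd_denom r) x N M :
  {subset (N : zmodClosed A) <= (M : zmodClosed A)} ->
  quot_proj M (locmul r (coord N x)) = locmul r (coord M x).
Proof.
move=> NM; rewrite -[quot_proj _]/(quot_proj_sub NM) locmul_morph //.
  by congr (locmul r _); exact: completion_proj.
exact: finindex_torsion.
Qed.

(** Acts as the scalar [r] on the 2-primary part and as 0 on the odd part; the finite quotients are
    torsion, so each coordinate is covered. *)
Definition clocmul r (r_odd : odd_denom r) x : Ahat :=
  ProfiniteCompletion (completion_of_coherent (locmul_coherent r_odd x)).

Lemma coord_clocmul N r (hr : odd_denom r) x :
  coord N (clocmul hr x) = locmul r (coord N x).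
Proof. by []. Qed.

Lemma clocmul_zmod_morphism r (hr : odd_denom r) : zmod_morphism (clocmul hr).
Proof.
move=> x y; apply: completion_eq => N.
rewrite -!/(coord N _) raddfB !coord_clocmul raddfB locmulBr //;
  exact: finindex_torsion.
Qed.
HB.instance Definition _ r (hr : odd_denom r) :=
  GRing.isZmodMorphism.Build Ahat Ahat (clocmul hr) (clocmul_zmod_morphism hr).

Lemma clocmulBl r s (hr : odd_denom r) (hs : odd_denom s)
    (hrs : odd_denom (r - s)) x :
  clocmul hrs x = clocmul hr x - clocmul hs x.
Proof.
apply: completion_eq => N; rewrite -!/(coord N _) raddfB !coord_clocmul.
by rewrite locmulBl //; exact: finindex_torsion.
Qed.

Lemma clocmulM r s (hr : odd_denom r) (hs : odd_denom s)
    (hrs : odd_denom (r * s)) x :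
  clocmul hr (clocmul hs x) = clocmul hrs x.
Proof.
apply: completion_eq => N; rewrite -!/(coord N _) !coord_clocmul.
by rewrite locmulM //; exact: finindex_torsion.
Qed.

Lemma coordwise_clocmul H r (hr : odd_denom r) x : coordwise H ->
  H (clocmul hr x) = clocmul hr (H x).
Proof.
move=> cH; apply: completion_eq => N; have [K [h hE]] := cH N.
rewrite -!/(coord N _) coord_clocmul !hE coord_clocmul locmul_morph //.
exact: finindex_torsion.
Qed.

End Completion.

(** * Homomorphisms out of a direct sum *)

Section DirectSum.
Variables (I : choiceType) (A : I -> zmodType).
Local Notation S := (direct_sum A).
Implicit Types (x y : S) (B : zmodType).

Definition dproj i x : A i := direct_sum_val x i.

Lemma dproj_zmod_morphism i : zmod_morphism (dproj i).
Proof.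
by move=> x y; rewrite /dproj -[direct_sum_val _]/(\val (x - y)) raddfB.
Qed.
HB.instance Definition _ i :=
  GRing.isZmodMorphism.Build S (A i) (dproj i) (dproj_zmod_morphism i).

Lemma dprojB i x y : dproj i (x - y) = dproj i x - dproj i y.
Proof. exact: dproj_zmod_morphism. Qed.

Lemma direct_sum_eq x y : (forall i, dproj i x = dproj i y) -> x = y.
Proof. by move=> xy; apply/val_inj/functional_extensionality_dep. Qed.

Definition delta_val i (a : A i) : zprod A := dfwith (fun j => 0 : A j) i a.

Lemma delta_finsupp i (a : A i) : delta_val a \in @finsupp _ A.
Proof.
apply/asboolP; apply: (@sub_finite_set _ _ [set i]) => // j /= dj.
apply/eqP; apply: contraNT dj => ij.
by rewrite /delta_val dfwithout // eq_sym.
Qed.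

Definition delta i (a : A i) : S := DirectSum (delta_finsupp a).

Lemma delta_in i (a : A i) : dproj i (delta a) = a.
Proof. exact: dfwithin. Qed.

Lemma delta_out i j (a : A i) : j != i -> dproj j (delta a) = 0.
Proof. by move=> ji; apply: dfwithout; rewrite eq_sym. Qed.

Lemma delta_zmod_morphism i : zmod_morphism (@delta i).
Proof.
move=> a b; apply: direct_sum_eq => j; rewrite dprojB.
have [->|ji] := eqVneq j i; first by rewrite !delta_in.
by rewrite !delta_out // subr0.
Qed.
HB.instance Definition _ i :=
  GRing.isZmodMorphism.Build (A i) S (@delta i) (@delta_zmod_morphism i).

Lemma direct_sum_support x :
  exists2 s, uniq s & forall i, i \notin s -> dproj i x = 0.
Proof.
have /finite_seqP[s sE] : finite_set [set i | dproj i x != 0].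
  by apply/asboolP; exact: direct_sumP.
exists (undup s) => [|i]; first by rewrite undup_uniq.
rewrite mem_undup => /negP is_; apply/eqP/negPn/negP => xi.
by apply: is_; have : [set i | dproj i x != 0] i by []; rewrite sE.
Qed.

(** Induction on a list containing the support, subtracting one coordinate at a time. *)
Lemma direct_sum_ext0 B (F : {additive S -> B}) :
  (forall i (a : A i), F (delta a) = 0) -> forall x, F x = 0.
Proof.
move=> F0 x; have [s _] := direct_sum_support x.
elim: s x => [|i s IHs] x sx.
  suff -> : x = 0 by rewrite raddf0.
  by apply: direct_sum_eq => i; apply: sx.
rewrite -(subrK (delta (dproj i x)) x) raddfD F0 addr0; apply: IHs => j js.
rewrite dprojB; have [->|ji] := eqVneq j i; first by rewrite delta_in subrr.
by rewrite delta_out // subr0 sx // inE negb_or ji.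
Qed.

Lemma direct_sum_ext B (F F' : {additive S -> B}) :
  (forall i (a : A i), F (delta a) = F' (delta a)) -> F =1 F'.
Proof.
move=> FF' x; apply/eqP; rewrite -subr_eq0; apply/eqP.
by apply: (@direct_sum_ext0 _ (F \- F')) => i a /=; rewrite FF' subrr.
Qed.

Lemma direct_sum_lift B (f : forall i, A i -> B) :
  (forall i, zmod_morphism (f i)) ->
  exists F : {additive S -> B}, forall i (a : A i), F (delta a) = f i a.
Proof.
move=> fB; pose F x := \sum_(i \in [set: I]) f i (dproj i x).
have f0 i : f i 0 = 0 by rewrite -(subrr 0) fB subrr.
(* Any duplicate-free list containing the support computes [F]; additivity then follows by using one
   list for [x], [y] and [x - y]. *)
have FE x s : uniq s -> (forall i, i \notin s -> dproj i x = 0) ->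
    F x = \sum_(i <- s) f i (dproj i x).
  move=> us sx; rewrite /F (fsbigE s) //.
    by apply: eq_bigl => i; rewrite in_setT.
  by move=> i _ /sx ->.
have FB : zmod_morphism F.
  move=> x y; have [s _ sx] := direct_sum_support x.
  have [t _ ty] := direct_sum_support y.
  have stx i : i \notin undup (s ++ t) -> dproj i x = 0 /\ dproj i y = 0.
    by rewrite mem_undup mem_cat negb_or => /andP[/sx ? /ty ?].
  have us := undup_uniq (s ++ t).
  rewrite !(FE _ _ us); try by [move=> i /stx[] |
    move=> i /stx[xi yi]; rewrite dprojB xi yi subr0].
  by rewrite -sumrB; apply: eq_bigr => i _; rewrite dprojB fB.
pose FM := GRing.isZmodMorphism.Build S B F FB.
pose FA : {additive S -> B} := HB.pack F FM.
exists FA => i a; rewrite -[FA _]/(F _) (FE _ [:: i]) //.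
  by rewrite big_seq1 delta_in.
by move=> j; rewrite inE => /delta_out ->.
Qed.

End DirectSum.

(** * The groups Z[1/q] and the homomorphisms between them *)

Section PowerFractions.
Variable q : nat.

Definition powfrac_pred : {pred rat} :=
  [pred x : rat | `[< exists r a, x * (q ^ r)%:R = a%:~R >]].

Lemma powfrac_subring_closed : subring_closed powfrac_pred.
Proof.
split=> [|x y /asboolP[r [a xa]] /asboolP[s [b yb]]
         |x y /asboolP[r [a xa]] /asboolP[s [b yb]]]; apply/asboolP.
- by exists 0%N, 1; rewrite mulr1.
- exists (r + s)%N, (a * (q ^ s)%N%:Z - b * (q ^ r)%N%:Z).
  rewrite mulrzBr !intrM -xa -yb expnD natrM mulrBl mulrA.
  by rewrite [_%:R * _%:R in X in _ - X]mulrC mulrA.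
- exists (r + s)%N, (a * b).
  by rewrite intrM -xa -yb expnD natrM mulrACA.
Qed.
HB.instance Definition _ :=
  GRing.isSubringClosed.Build rat powfrac_pred powfrac_subring_closed.

(** The fractions with denominator a power of [q] form a subring containing 1/q, hence contain the
    smallest such subring. *)
Lemma Zinv_powfrac (x : Zinv q) : exists r a, Zinv_val x * (q ^ r)%:R = a%:~R.
Proof.
(* For [q = 0] the exponent 1 makes the left-hand side vanish. *)
have [q0|q0] := eqVneq q 0%N.
  exists 1%N, 0; rewrite expn1 (_ : q%:R = 0) ?mulr0 //.
  by apply/eqP; rewrite pnatr_eq0 q0.
suff /asboolP : Zinv_val x \in powfrac_pred by [].
move/asboolP: (ZinvP x); apply; apply/asboolP.
by exists 1%N, 1; rewrite expn1 mulVf // pnatr_eq0.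
Qed.

End PowerFractions.

Section Zinv.
Implicit Types p q : nat.

Lemma Zinv_valB q (x y : Zinv q) : Zinv_val (x - y) = Zinv_val x - Zinv_val y.
Proof. exact: (raddfB \val). Qed.

Lemma Zinv_valMz q (x : Zinv q) a : Zinv_val (x *~ a) = Zinv_val x * a%:~R.
Proof. by rewrite -[LHS]/(\val _) raddfMz mulrzr. Qed.

Lemma Zinv_odd_denom q (x : Zinv q) : odd q -> odd_denom (Zinv_val x).
Proof.
move=> q_odd; have [r [a xa]] := Zinv_powfrac x.
by exists a, (q ^ r)%N; split=> //; rewrite oddX q_odd orbT.
Qed.

Lemma Zinv_divisible q n (x : Zinv q) : (0 < q)%N -> exists y, y *~ (q ^ n)%N = x.
Proof.
move=> q_gt0; have qV : q%:R^-1 \in Zinv_pred q by apply/asboolP.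
have xq : Zinv_val x * q%:R^-1 ^+ n \in Zinv_pred q.
  by rewrite rpredM ?rpredX // ZinvP.
exists (MkZinv xq); apply: val_inj; rewrite /= Zinv_valMz /=.
rewrite -pmulrn natrX exprVn mulfVK // expf_neq0 // pnatr_eq0.
by rewrite -lt0n.
Qed.

(** Every element of Z[1/p] is divisible by all powers of [p], so the numerator [a] of its image is
    too, the denominator being prime to [p]; this forces [a = 0]. *)
Lemma Zinv_hom_eq0 p q (f : {additive Zinv p -> Zinv q}) x :
  prime p -> prime q -> p != q -> f x = 0.
Proof.
move=> p_prime q_prime pq; have [r [a xa]] := Zinv_powfrac (f x).
have q0 s : (q ^ s)%:R != 0 :> rat.
  by rewrite pnatr_eq0 -lt0n expn_gt0 prime_gt0.
have pa n : (p ^ n %| `|a|)%N.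
  have [y yx] := Zinv_divisible n x (prime_gt0 p_prime).
  have [s [b yb]] := Zinv_powfrac (f y).
  have : a * (q ^ s)%N = b * (q ^ r)%N * (p ^ n)%N :> int.
    apply: (@intr_inj rat); rewrite !intrM -xa -yb -yx raddfMz Zinv_valMz.
    rewrite -!mulrA; congr (_ * _).
    by rewrite mulrC [X in X * _ = _]mulrC -mulrA.
  move/(congr1 absz); rewrite !abszM !absz_nat => e.
  have : (p ^ n %| `|a| * q ^ s)%N by rewrite e dvdn_mull.
  rewrite Gauss_dvdl // coprimeXl // coprimeXr //.
  by rewrite prime_coprime // dvdn_prime2.
apply: val_inj; apply/eqP; rewrite -[_ == _](mulIr_eq0 _ (mulIf (q0 r))) xa.
(* The exponent |a| suffices, because |a| < p^|a|. *)
rewrite intr_eq0 -absz_eq0; apply: contraTT (pa `|a|%N).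
rewrite -lt0n => a_gt0; apply/negP => /(dvdn_leq a_gt0).
by rewrite leqNgt ltn_expl // prime_gt1.
Qed.

Lemma Zinv_hom_rank1 q q' (f : {additive Zinv q -> Zinv q'}) x y :
  x != 0 -> f x = 0 -> f y = 0.
Proof.
(* Rank one: [y] has a nonzero multiple that is also a multiple of [x], and the target is
   torsion-free. *)
move=> x0 fx; pose n := numq (Zinv_val x) * denq (Zinv_val y).
have n0 : n != 0 by rewrite mulf_neq0 ?denq_neq0 // numq_eq0.
have yx : y *~ n = x *~ (numq (Zinv_val y) * denq (Zinv_val x)).
  apply: val_inj; rewrite /= !Zinv_valMz !intrM !numqE.
  by rewrite -!mulrA mulrCA [(denq (Zinv_val x))%:~R * _]mulrC.
have : f y *~ n = 0 by rewrite -raddfMz yx raddfMz fx mul0rz.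
move=> /(congr1 (@Zinv_val q')); rewrite Zinv_valMz /= => /eqP.
rewrite mulf_eq0 intr_eq0 (negPf n0) orbF => /eqP h.
exact: val_inj.
Qed.

Lemma Zinv_reduction q k : odd q ->
  exists F : {additive Zinv q -> 'Z_(2 ^ k.+1)}, forall x a d,
    is_frac (Zinv_val x) a d -> F x *~ d = a%:~R.
Proof.
move=> q_odd; pose B : zmodType := 'Z_(2 ^ k.+1).
have tB (b : B) : torsion b by apply/finite_torsion/finite_finset.
have killB (b : 'Z_(2 ^ k.+1)) : b *+ 2 ^ k.+1 = 0.
  by rewrite -mulr_natr pchar_Zp ?mulr0 // (@leq_pexp2l 2 1).
pose f (x : Zinv q) : B := locmul (Zinv_val x) 1.
have fB : zmod_morphism f.
  by move=> x y; rewrite /f Zinv_valB locmulBl //; apply: Zinv_odd_denom.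
pose FM := GRing.isZmodMorphism.Build (Zinv q) B f fB.
pose F : {additive Zinv q -> B} := HB.pack f FM.
exists F => x a d [d_odd xd]; rewrite -[F x]/(f x).
have [_ [a' [d' [[d'_odd xd'] fxd']]]] :
    locmul_rel (Zinv_val x) (1 : B) (f x).
  by apply: locmul_relP => //; apply: Zinv_odd_denom.
apply/eqP; rewrite -subr_eq0; apply/eqP.
apply: (@mulrn_pow2_odd_eq0 _ _ k.+1 d') => //.
have a'd : a' * d = a * d' :> int.
  by apply: (@intr_inj rat); rewrite !intrM -xd -xd' mulrAC.
have := congr1 (fun b => b *~ d) fxd'; rewrite /= -!mulrzA a'd => e.
by rewrite mulrzBl -!mulrzA [d%:Z * _]mulrC -e subrr.
Qed.

End Zinv.

Section MainArguments.
Variable q : nat -> nat.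
Hypotheses (q_inj : injective q) (q_prime : forall i, prime (q i))
  (q_odd : forall i, odd (q i)).

Local Notation R i := (Zinv (q i)).
Local Notation A := (fun i : nat => Zinv (q i) : zmodType).
Local Notation G := (direct_sum A).
Local Notation dl i := (@delta _ A i).
Local Notation Ghat := (profinite_completion G).

Lemma sumZinv_residually_finite : residually_finite G.
Proof.
apply: residually_finite_separated => x x0.
have [i xi] : exists i, dproj i x != 0.
  apply: contrapT => /forallNP h; move/eqP: x0; apply.
  apply: direct_sum_eq => i; apply/eqP/negPn/negP; exact: h.
have [a [d [d_odd xd]]] := Zinv_odd_denom (dproj i x) (q_odd i).
have [F FE] := Zinv_reduction `|a|%N (q_odd i).
exists ('Z_(2 ^ `|a|.+1) : zmodType), (F \o @dproj _ A i).
split; first exact: finite_finset.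
apply/eqP => /= f0; have a0 : a != 0.
  apply: contraNneq xi => a0; apply/eqP/val_inj/eqP; rewrite /=.
  move: xd; rewrite a0 => /eqP; rewrite mulf_eq0 pnatr_eq0.
  by case/orP => // /eqP d0; rewrite d0 in d_odd.
have := FE (dproj i x) a d (conj d_odd xd); rewrite f0 mul0rz => /esym a_eq0.
have a0n : (`|a|%N%:R : 'Z_(2 ^ `|a|.+1)) = 0.
  case: (a) a_eq0 => n //= /eqP.
  by rewrite NegzE mulrNz oppr_eq0 => /eqP.
have : (2 ^ `|a|.+1 %| `|a|)%N.
  move: a0n; rewrite Zp_nat => /(congr1 val) /=.
  rewrite Zp_cast ?(@leq_pexp2l 2 1) //.
  by move/eqP.
move/dvdn_leq; rewrite absz_gt0 a0 => /(_ isT); rewrite leqNgt.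
by rewrite (leq_trans (leqnSn _)) // ltn_expl.
Qed.

Lemma sumZinv_hopfian : hopfian G.
Proof.
move=> f f_surj.
pose dA i : {additive A i -> G} := @delta _ A i.
pose pA i : {additive G -> A i} := @dproj _ A i.
have fdiag j x : dproj j (f x) = dproj j (f (dl j (dproj j x))).
  pose F1 : {additive G -> A j} := pA j \o f.
  pose F2 : {additive G -> A j} := F1 \o dA j \o pA j.
  apply: (@direct_sum_ext _ _ _ F1 F2) => i a.
  change (F1 (dl i a) = F1 (dl j (dproj j (dl i a)))).
  have [ji|ij] := eqVneq j i; first by case: i / ji a => a; rewrite delta_in.
  rewrite delta_out //.
  rewrite [RHS](_ : _ = 0); last by rewrite raddf0 raddf0.
  apply: (@Zinv_hom_eq0 _ _ (F1 \o dA i)) => //.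
  by apply: contra_neq ij => /q_inj.
have kerf x : f x = 0 -> x = 0.
  move=> fx; apply: direct_sum_eq => j; apply/eqP/negPn/negP => xj.
  have [y] := f_surj (dl j 1).
  move=> /(congr1 (dproj j)); rewrite fdiag delta_in.
  have -> : dproj j (f (dl j (dproj j y))) = 0.
    apply: (@Zinv_hom_rank1 _ _
      (pA j \o f \o dA j) _ _ xj) => /=.
    by rewrite -fdiag fx raddf0.
  by move/esym/eqP; rewrite oner_eq0.
move=> x y fxy; apply/eqP; rewrite -subr_eq0; apply/eqP/kerf.
by rewrite raddfB fxy subrr.
Qed.

Local Notation e1 := (@clocmul G 1 odd_denom1).

Lemma e1_idem (z : Ghat) : e1 (e1 z) = e1 z.
Proof.
have h : odd_denom (1 * 1) by rewrite mulr1; exact: odd_denom1.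
by rewrite (clocmulM _ _ h); apply: completion_eq => N /=; rewrite mulr1.
Qed.

Lemma e1_clocmul r (hr : odd_denom r) (z : Ghat) :
  e1 (clocmul hr z) = clocmul hr z /\ clocmul hr (e1 z) = clocmul hr z.
Proof.
have h : odd_denom (1 * r) by rewrite mul1r.
have h' : odd_denom (r * 1) by rewrite mulr1.
rewrite (clocmulM _ _ h) (clocmulM _ _ h').
by split; apply: completion_eq => N /=; rewrite ?mul1r ?mulr1.
Qed.

Lemma e1_incl_delta i (a : R i) (ha : odd_denom (Zinv_val a)) :
  clocmul ha (incl (dl i 1)) = e1 (incl (dl i a)).
Proof.
apply: completion_eq => N; rewrite -!/(coord N _) !coord_clocmul !coord_incl.
set b1 := \pi _; set ba := \pi _.
have [a0 [d0 [d0_odd ad0]]] := ha.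
have adE : a *~ d0 = 1 *~ a0.
  by apply: val_inj; rewrite /= !Zinv_valMz mul1r -ad0.
apply: locmul_eq; rewrite -[Zinv_val a]mul1r.
apply: (@locmul_rel_frac _ 1 _ b1 ba _ a0 d0) => //.
  by rewrite /ba /b1 -!raddfMz adE.
by apply: locmul_relP; [exact: odd_denom1 | exact: finindex_torsion].
Qed.

Definition shift_comp (v : nat -> Ghat) i (a : R i) : Ghat :=
  incl (dl i a) - e1 (incl (dl i a)) +
  clocmul (Zinv_odd_denom a (q_odd i)) (v i).

Lemma shift_comp_zmod_morphism v i : zmod_morphism (@shift_comp v i).
Proof.
move=> a b; rewrite /shift_comp.
have -> : incl (dl i (a - b)) = incl (dl i a) - incl (dl i b).
  by rewrite -raddfB; congr incl; exact: raddfB.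
have -> : clocmul (Zinv_odd_denom (a - b) (q_odd i)) (v i) =
    clocmul (Zinv_odd_denom a (q_odd i)) (v i) -
    clocmul (Zinv_odd_denom b (q_odd i)) (v i) by exact: clocmulBl.
rewrite (clocmul_zmod_morphism odd_denom1 (incl _)).
rewrite [in RHS]opprD [RHS]addrACA; congr (_ + _).
by rewrite opprD addrACA -opprD.
Qed.

(* The endomorphism of the completion that is the identity on the p-primary
   parts for odd p, and sends the i-th basis vector of the 2-primary part to
   the 2-primary part of [v i]. *)
Lemma exists_shift (v : nat -> Ghat) : exists H : {additive Ghat -> Ghat},
  coordwise H /\ forall i (a : R i), H (incl (dl i a)) = shift_comp v a.
Proof.
have [F FE] := direct_sum_lift (shift_comp_zmod_morphism v).
exists (ext F); split=> [|i a]; first exact: ext_coordwise.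
exact: etrans (ext_incl F _) (FE i a).
Qed.

Lemma sumZinv_completion_not_hopfian : ~ topologically_hopfian Ghat.
Proof.
move=> hopfG.
pose up i := incl (dl i.+1 1).
pose down i := if i is j.+1 then incl (dl j 1) else 0.
have [H [cH HE]] := exists_shift down.
have [K [cK KE]] := exists_shift up.
have HK : forall z, H (K z) = z.
  apply: coordwise_id; first exact: (coordwise_comp cH cK).
  pose F1 : {additive G -> Ghat} := H \o K \o @incl G.
  apply: (@direct_sum_ext _ _ _ F1 (@incl G)) => i a.
  change (H (K (incl (dl i a))) = incl (dl i a)).
  pose ha := Zinv_odd_denom a (q_odd i).
  have Hup : clocmul ha (H (up i)) = e1 (incl (dl i a)).
    rewrite HE -e1_incl_delta /shift_comp /= raddfD raddfB /=.
    have [_ ->] := e1_clocmul ha (incl (dl i.+1 1)); rewrite subrr add0r.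
    have [_ <-] := e1_clocmul ha (incl (dl i 1)).
    by congr clocmul; apply: completion_eq.
  have He : H (incl (dl i a)) - e1 (H (incl (dl i a))) =
      incl (dl i a) - e1 (incl (dl i a)).
    rewrite HE /shift_comp raddfD raddfB /= e1_idem subrr add0r.
    rewrite (e1_clocmul _ _).1. by rewrite addrK.
  rewrite KE /shift_comp raddfD raddfB /= !(coordwise_clocmul _ _ cH) He Hup.
  by rewrite subrK.
have H_inj : injective H.
  exact: (hopfG H (coordwise_continuous cH) (fun y => ex_intro _ (K y) (HK y))).
pose z := e1 (incl (dl 0%N 1)).
have Hz : H z = 0.
  rewrite /z (coordwise_clocmul _ _ cH) HE /shift_comp /= raddf0 addr0.
  by rewrite raddfB /= e1_idem subrr.
have : z = 0 by apply: H_inj; rewrite Hz raddf0.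
have [F FE] := Zinv_reduction 0 (q_odd 0%N).
pose F0 : {additive G -> 'Z_2} := F \o @dproj _ A 0%N.
have finZ2 : finite_set [set: 'Z_2] by exact: finite_finset.
move=> z0; have tpi : torsion (\pi_({ideal_quot (ker F0)}) (dl 0%N 1)).
  exact: (@finindex_torsion _ (ker_finindex F0 finZ2)).
have zK : locmul 1 (\pi_({ideal_quot (ker F0)}) (dl 0%N 1)) = 0.
  exact: (congr1 (coord (ker_finindex F0 finZ2)) z0).
have := congr1 (ker_quot (f := F0)) zK.
rewrite raddf0 locmul_morph //; last exact: odd_denom1.
rewrite -[X in locmul 1 X]/(ker_quot (f := F0)
  (\pi_({ideal_quot (ker F0)}) (dl 0%N 1))) ker_quotE.
have -> : F0 (dl 0%N 1) = 1.
  by rewrite -[RHS](FE 1 1 1%N) // -[F0 _]/(F (dproj 0%N (dl 0%N 1))) delta_in.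
rewrite (locmul_eq (c := 1)); first by move/eqP; rewrite oner_eq0.
split; first by exists 1%N; apply: val_inj.
by exists 1, 1%N.
Qed.

End MainArguments.

Theorem mainTheorem2 (q : nat -> nat) (q_inj : injective q)
    (q_prime : forall i, prime (q i)) (q_odd : forall i, odd (q i)) :
  let G : zmodType := direct_sum (fun i : nat => Zinv (q i)) in
  residually_finite G /\ hopfian G /\
  ~ topologically_hopfian (profinite_completion G).
Proof.
split; first exact: sumZinv_residually_finite.
split; first exact: sumZinv_hopfian.
exact: sumZinv_completion_not_hopfian.
Qed.
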